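(* Let $F$ be a probability distribution supported on $(0,\infty)$ with a positive Lebesgue density $f$ on $(0,\infty)$ which has bounded increase, i.e. $\delta_f>-\infty$. Let $h=f/\overline F$ and $M_2=\limsup_{x\to\infty}x\,h(x)$. Then the following statements are equivalent: 1. $F\in\mathcal{D}$; 2. $F\in\mathcal{D}\cap\mathcal{L}$; 3. $M_2<\infty$.
   Context: $\overline F=1-F$ is the right tail of $F$, and $h$ is the hazard rate. $F\in\mathcal{D}$ (dominatedly varying tail) means that $\liminf_{x\to\infty}\overline F(ux)/\overline F(x)>0$ for all (equivalently, for some) $u>1$. $F\in\mathcal{L}$ (long tail) means that $\lim_{x\to\infty}\overline F(x-y)/\overline F(x)=1$ for every $y\in(-\infty,\infty)$. For a positive function $g$ on $(0,\infty)$, the (sign-normalized) lower Matuszewska index $\delta_g\in[-\infty,\infty]$ is the supremum of those $\delta\in\mathbb{R}$ for which there is a constant $C>0$ such that for every $U>1$, as $x\to\infty$, $g(ux)/g(x)\le C(1+o(1))u^{-\delta}$ uniformly in $u\in[1,U]$ (with $\sup\emptyset=-\infty$). The density $f$ has bounded increase if $\delta_f>-\infty$. *)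

(* Defs.v *)
From HB Require Import structures.
From mathcomp Require Export all_boot all_order all_algebra.
From mathcomp Require Export all_classical all_reals all_analysis.

Set Implicit Arguments.
Unset Strict Implicit.
Unset Printing Implicit Defensive.

Import Order.TTheory GRing.Theory Num.Theory.
Import numFieldNormedType.Exports.

Local Open Scope classical_set_scope.
Local Open Scope ring_scope.

Definition distr_fun (R : realType)
    (F : probability (measurableTypeR R) R) (x : R) : R :=
  fine (F `]-oo, x]%classic).

Definition tail (R : realType)
    (F : probability (measurableTypeR R) R) (x : R) : R :=
  1 - distr_fun F x.

Definition hazard_rate (R : realType)
    (F : probability (measurableTypeR R) R) (f : R -> R) (x : R) : R :=
  f x / tail F x.

Definition dominatedly_varying (R : realType)
    (F : probability (measurableTypeR R) R) : Prop :=
  forall u : R, 1 < u ->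
    (0 < limf_einf (fun x : R => (tail F (u * x) / tail F x)%:E) +oo%R)%E.

Definition long_tailed (R : realType)
    (F : probability (measurableTypeR R) R) : Prop :=
  forall y : R, tail F (x - y) / tail F x @[x --> +oo] --> (1 : R).

(* [g] is only meant to be used on ]0, +oo[. The bound by [C (1 + o(1))],
   uniform in [u], is spelled out: for every [e > 0] there is a threshold for
   [x], common to all [u] in [1, U]. The constant [C] depends on neither [U]
   nor [e]. *)
Definition matuszewska_bound (R : realType) (g : R -> R) (delta : R) : Prop :=
  exists2 C : R, 0 < C &
    forall U : R, 1 < U ->
    forall e : R, 0 < e ->
    \forall x \near +oo,
      forall u : R, 1 <= u <= U ->
        g (u * x) / g x <= C * (1 + e) * u `^ (- delta).

Definition lower_matuszewska_index (R : realType) (g : R -> R) : \bar R :=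
  ereal_sup [set delta%:E | delta in [set delta : R | matuszewska_bound g delta]].

Definition bounded_increase (R : realType) (g : R -> R) : Prop :=
  (-oo < lower_matuszewska_index g)%E.

(* Main.v *)
(** Write T for the tail of F. Bounded increase, used only for ratios
[u] in [[1, 2]], gives a constant [K] with [f t <= K * f a] for
[a <= t <= 2 a] and [a] large. If F is dominatedly varying, then
[T (x / 2) >= T (x / 2) - T x >= (x / 2) * f x / K] together with
[T x >= c * T (x / 2)] bounds [x * h x]. Conversely, if [x * h x <= M] for
large [x], then [T a - T b <= M * T a / a * (b - a)]: taking [b = a + z]
with [z] fixed gives a long tail, and taking [b = (1 + w) a] with [w] small
gives [T b >= T a / 2], which is iterated to reach any ratio [u]. *)

Require Import Defs.
From mathcomp Require Import measurable_realfun lra ring.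

Import Order.TTheory GRing.Theory Num.Theory.
Import numFieldNormedType.Exports.

Local Open Scope classical_set_scope.
Local Open Scope ring_scope.

(** * Limits superior and inferior as eventual real bounds *)

Lemma limf_esup_ltyP (R : realType) (g : R -> R) (G : set_system R)
    (FG : Filter G) :
  (limf_esup (fun x => (g x)%:E) G < +oo)%E <->
  exists M : R, \forall x \near G, g x <= M.
Proof.
rewrite limf_esupE; split.
- move=> /ereal_inf_lt[_ [V GV <-] supV];
  exists (fine (ereal_sup [set (g x)%:E | x in V])).
  apply: filterS GV => x Vx.
  have gx : ((g x)%:E <= ereal_sup [set (g x)%:E | x in V])%E.
    by apply: ereal_sup_ubound; exists x.
  (* [fine] never takes its default value here: [supV] excludes +oo, and [gx] excludes -oo once [V]
     has a point. *)
  by move: supV gx; case: ereal_sup => [r||] //=; rewrite lee_fin.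
- move=> [M gM]; apply: (@le_lt_trans _ _ M%:E); last exact: ltry.
  apply: (@le_trans _ _ (ereal_sup [set (g x)%:E | x in [set x | g x <= M]])).
    by apply: ereal_inf_lbound; exists [set x | g x <= M].
  by apply: ge_ereal_sup => _ [x /= gxM <-]; rewrite lee_fin.
Qed.

Lemma limf_einf_gt0P (R : realType) (g : R -> R) (G : set_system R)
    (FG : Filter G) :
  (0 < limf_einf (fun x => (g x)%:E) G)%E <->
  exists2 c : R, 0 < c & \forall x \near G, c <= g x.
Proof.
rewrite limf_einfE; split.
- move=> /ereal_sup_gt[_ [V GV <-] infV].
  have gV x : V x -> (ereal_inf [set (g x)%:E | x in V] <= (g x)%:E)%E.
    by move=> Vx; apply: ereal_inf_lbound; exists x.
  move: infV gV; case: ereal_inf => [r| _ gV|//].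
  + rewrite lte_fin => r0 gV; exists r => //.
    by apply: filterS GV => x /gV; rewrite lee_fin.
  (* An infimum equal to +oo forces [V] to be empty, so any positive constant serves. *)
  + by exists 1 => //; apply: filterS GV => x /gV.
- move=> [c c0 cg]; apply: (@lt_le_trans _ _ c%:E); first by rewrite lte_fin.
  apply: (@le_trans _ _ (ereal_inf [set (g x)%:E | x in [set x | c <= g x]])).
    by apply: le_ereal_inf_tmp => _ [x /= cgx <-]; rewrite lee_fin.
  by apply: ereal_sup_ubound; exists [set x | c <= g x].
Qed.

(** The threshold is taken positive so that every point beyond it can be divided by. *)
Lemma near_pinftyP (R : realType) (P : R -> Prop) :
  (\forall x \near +oo, P x) <->
  exists2 A : R, 0 < A & forall x, A <= x -> P x.
Proof.
split=> [[A [_ AP]]|[A A0 AP]].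
- exists (Num.max A 0 + 1) => [|x].
    by rewrite ltr_pwDr// le_max lexx orbT.
  move=> Ax; apply: AP; apply: lt_le_trans Ax.
  by rewrite ltr_pwDr// le_max lexx.
- by near=> x; apply: AP; near: x; apply: nbhs_pinfty_ge; exact: num_real.
Unshelve. all: by end_near.
Qed.

Lemma bounded_increase_doubling (R : realType) (f : R -> R)
    (f_pos : forall x : R, 0 < x -> 0 < f x) :
  bounded_increase f ->
  exists2 K : R, 0 < K & exists2 A : R, 0 < A &
    forall a t, A <= a -> a <= t <= 2 * a -> f t <= K * f a.
Proof.
move=> /ereal_sup_gt[_ [delta [C C0 fC] <-] _].
have /near_pinftyP[A A0 fA] := fC 2 (ltr1n _ _) 1 ltr01.
(* The index bound is taken with [U = 2] and [e = 1]. The sign of [delta] is unknown, so the power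
   is bounded through [u ^ (- delta) <= u ^ |delta| <= 2 ^ |delta|]. *)
exists (C * (1 + 1) * 2 `^ `|delta|).
  by rewrite mulr_gt0 ?powR_gt0// mulr_gt0.
exists A => // a t Aa /andP[at_ ta].
have a0 : 0 < a by exact: lt_le_trans Aa.
rewrite -ler_pdivrMr; last exact: f_pos.
have u12 : 1 <= t / a <= 2 by rewrite ler_pdivlMr// ler_pdivrMr// mul1r at_ ta.
have := fA a Aa (t / a) u12; rewrite divfK ?gt_eqF// => /le_trans; apply.
rewrite ler_wpM2l ?mulr_ge0 ?addr_ge0//; first exact: ltW.
have [u1 u2] := andP u12.
apply: (@le_trans _ _ ((t / a) `^ `|delta|)).
  by apply: ler_powR => //; rewrite -normrN ler_norm.
by apply: ge0_ler_powR; rewrite ?nnegrE// (le_trans _ u1).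
Qed.

(** * Increments of the tail as integrals of the density *)

Section tail.
Variables (R : realType) (F : probability (measurableTypeR R) R) (f : R -> R).

Lemma tail_sub (a b : R) : a <= b ->
  tail F a - tail F b = fine (F `]a, b]%classic).
Proof.
move=> ab; rewrite /tail /distr_fun.
have -> : `]-oo, b]%classic = `]-oo, a]%classic `|` `]a, b]%classic :> set R.
  by rewrite -itv_bndbnd_setU.
rewrite measureU//; last first.
  by apply/seteqP; split=> x //=; rewrite !in_itv/=; move=> [xa /andP[ax _]]; lra.
rewrite fineD ?fin_num_measure//; lra.
Qed.

Lemma tail_nonincreasing (a b : R) : a <= b -> tail F b <= tail F a.
Proof. by move=> ab; rewrite -subr_ge0 tail_sub// fine_ge0. Qed.

Lemma tail_ge0 (a : R) : 0 <= tail F a.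
Proof.
rewrite subr_ge0 -lee_fin fineK ?fin_num_measure//.
exact: probability_le1.
Qed.

Hypotheses
    (f_meas : measurable_fun (`]0, +oo[%classic : set R) f)
    (f_pos : forall x : R, 0 < x -> 0 < f x)
    (f_density : forall A : set R, measurable A -> A `<=` `]0, +oo[%classic ->
       F A = (\int[lebesgue_measure]_(x in A) (f x)%:E)%E).

Lemma tail_sub_integral (a b : R) : 0 <= a -> a <= b ->
  (tail F a - tail F b)%:E =
  (\int[lebesgue_measure]_(x in `]a, b]) (f x)%:E)%E.
Proof.
move=> a0 ab; rewrite tail_sub// fineK ?fin_num_measure// f_density//.
by move=> x /=; rewrite !in_itv/= andbT => /andP[ax _]; exact: le_lt_trans ax.
Qed.

Lemma integral_cst_itv_oc (a b m : R) : a <= b ->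
  (\int[lebesgue_measure]_(x in `]a, b]) m%:E)%E = (m * (b - a))%:E.
Proof.
move=> ab; rewrite integral_cst//= lebesgue_measure_itv/= lte_fin.
case: ltP => // ba; have -> : a = b by apply/le_anti; rewrite ab.
by rewrite mule0 subrr mulr0.
Qed.

Lemma measurable_density_itv (a b : R) : 0 <= a ->
  measurable_fun `]a, b] (fun x : measurableTypeR R => (f x)%:E).
Proof.
move=> a0; apply/measurable_EFinP; apply: measurable_funS f_meas => //.
by move=> x /=; rewrite !in_itv/= andbT => /andP[ax _]; exact: le_lt_trans ax.
Qed.

Lemma tail_sub_ge (a b m : R) : 0 <= a -> a <= b -> 0 <= m ->
  (forall t, a < t -> t <= b -> m <= f t) ->
  m * (b - a) <= tail F a - tail F b.
Proof.
move=> a0 ab m0 mf; rewrite -lee_fin tail_sub_integral// -integral_cst_itv_oc//.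
apply: ge0_le_integral => //.
- exact: measurable_density_itv.
- by move=> x /=; rewrite in_itv/= => /andP[ax xb]; rewrite lee_fin mf.
Qed.

Lemma tail_sub_le (a b m : R) : 0 <= a -> a <= b -> 0 <= m ->
  (forall t, a < t -> t <= b -> f t <= m) ->
  tail F a - tail F b <= m * (b - a).
Proof.
move=> a0 ab m0 mf; rewrite -lee_fin tail_sub_integral// -integral_cst_itv_oc//.
apply: ge0_le_integral => //.
- move=> x /=; rewrite in_itv/= => /andP[ax _].
  by rewrite lee_fin ltW// f_pos// (le_lt_trans a0).
- exact: measurable_density_itv.
- by move=> x /=; rewrite in_itv/= => /andP[ax xb]; rewrite lee_fin mf.
Qed.


(** * Tail asymptotics under a doubling bound on the density *)

Section tail_asymptotics.
Variables (K A : R).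
Hypotheses (K0 : 0 < K) (A0 : 0 < A)
  (fK : forall a t, A <= a -> a <= t <= 2 * a -> f t <= K * f a).

(** For [t] in []a, 2a]] the point [2a] lies in [[t, 2t]], so the doubling bound based at [t] gives
    [f (2a) / K <= f t]. *)
Lemma tail_sub_dyadic (a : R) : A <= a ->
  f (2 * a) / K * a <= tail F a - tail F (2 * a).
Proof.
move=> Aa; have a0 : 0 < a by exact: lt_le_trans Aa.
have -> : f (2 * a) / K * a = f (2 * a) / K * (2 * a - a) by congr (_ * _); lra.
apply: tail_sub_ge; try lra.
  by rewrite divr_ge0 ?(ltW K0)// ltW// f_pos; lra.
move=> t at_ ta; rewrite ler_pdivrMr// [leRHS]mulrC; apply: fK; lra.
Qed.

(** Beyond [max x A] the tail still loses a positive mass over a dyadic interval, while staying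
    nonnegative. *)
Lemma tail_gt0 (x : R) : 0 < tail F x.
Proof.
apply: (@lt_le_trans _ _ (tail F (Num.max x A))); last first.
  by apply: tail_nonincreasing; rewrite le_max lexx.
have Aa : A <= Num.max x A by rewrite le_max lexx orbT.
set a := Num.max x A in Aa *.
have a0 : 0 < a by exact: lt_le_trans Aa.
have p : 0 < f (2 * a) / K * a by rewrite mulr_gt0// divr_gt0// f_pos; lra.
by have := tail_sub_dyadic _ Aa; have := tail_ge0 (2 * a); lra.
Qed.

Lemma dominatedly_varying_hazard_bounded : dominatedly_varying F ->
  (limf_esup (fun x : R => (x * hazard_rate F f x)%:E) +oo%R < +oo)%E.
Proof.
move=> /(_ 2 (ltr1n _ _))/limf_einf_gt0P[c c0 /near_pinftyP[B B0 cB]].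
(* With [x] halved and T the tail, [2x * h (2x) <= 2K * T x / T (2x) <= 2K / c]. *)
apply/limf_esup_ltyP; exists (2 * K / c); apply/near_pinftyP.
exists (2 * Num.max A B) => [|x]; first by rewrite mulr_gt0// lt_max A0.
have -> : x = 2 * (x / 2) by lra.
move: (x / 2) => {}x; rewrite ler_pM2l// ge_max => /andP[Ax Bx].
have := cB _ Bx; rewrite ler_pdivlMr ?tail_gt0// => cx.
have fx : f (2 * x) * x <= K * tail F x.
  rewrite -ler_pdivrMl// mulrA (mulrC K^-1).
  by have := tail_sub_dyadic _ Ax; have := tail_ge0 (2 * x); lra.
rewrite /hazard_rate mulrA ler_pdivrMr ?tail_gt0//.
apply: (@le_trans _ _ (2 * (K * tail F x))); first lra.
have -> : 2 * K / c * tail F (2 * x) = 2 * (K * (tail F (2 * x) / c)).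
  by field; rewrite gt_eqF.
by rewrite !ler_pM2l// ler_pdivlMr// mulrC.
Qed.

(** On []a, b]] the density is [(t * h t) * T t / t], where T is the tail, and both [T t] and
    [1 / t] are largest at the left end. *)
Lemma hazard_bounded_tail_sub :
  (limf_esup (fun x : R => (x * hazard_rate F f x)%:E) +oo%R < +oo)%E ->
  exists2 M : R, 0 < M & exists2 B : R, 0 < B &
    forall a b, B <= a -> a <= b ->
      tail F a - tail F b <= M * tail F a / a * (b - a).
Proof.
move=> /limf_esup_ltyP[M /near_pinftyP[B B0 hM]].
(* The maximum with 1 makes the constant positive, so that a step of relative size [1 / (2M)] can be
   taken later. *)
exists (Num.max M 1); first by rewrite lt_max ltr01 orbT.
exists B => // a b Ba ab; have a0 : 0 < a by exact: lt_le_trans Ba.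
have M1 : 0 <= Num.max M 1 by rewrite le_max ler01 orbT.
apply: tail_sub_le => //; first exact: ltW.
  by rewrite divr_ge0 ?mulr_ge0 ?tail_ge0// ltW.
move=> t at_ tb; have t0 : 0 < t by exact: lt_trans at_.
have : t * hazard_rate F f t <= Num.max M 1.
  by rewrite le_max hM//; lra.
rewrite /hazard_rate mulrA ler_pdivrMr ?tail_gt0// mulrC -ler_pdivlMr//.
move=> /le_trans; apply; apply: ler_pM => //.
- by rewrite mulr_ge0 ?tail_ge0.
- by rewrite invr_ge0 ltW.
- by rewrite ler_wpM2l// tail_nonincreasing// ltW.
- by rewrite lef_pV2 ?posrE// ltW.
Qed.

Lemma hazard_bounded_dominatedly_varying :
  (limf_esup (fun x : R => (x * hazard_rate F f x)%:E) +oo%R < +oo)%E ->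
  dominatedly_varying F.
Proof.
move=> /hazard_bounded_tail_sub[M M0 [B B0 TM]] u u1.
(* With this [w], the bound on the loss from [a] to [(1 + w) a] is exactly half of the tail at
   [a]. *)
pose w : R := (2 * M)^-1.
have w0 : 0 < w by rewrite invr_gt0 mulr_gt0.
have half a : B <= a -> tail F a / 2 <= tail F ((1 + w) * a).
  move=> Ba; have a0 : 0 < a by exact: lt_le_trans Ba.
  have aw : a <= (1 + w) * a by rewrite ler_peMl ?lerDl ?(ltW a0) ?(ltW w0).
  have := TM _ _ Ba aw.
  have -> : M * tail F a / a * ((1 + w) * a - a) = tail F a / 2.
    by rewrite /w; field; rewrite !gt_eqF.
  lra.
have halfX n a : B <= a -> tail F a / 2 ^+ n <= tail F ((1 + w) ^+ n * a).
  move=> Ba; elim: n => [|n IH]; first by rewrite !expr0 mul1r divr1.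
  have w1 : 1 <= (1 + w) ^+ n by rewrite exprn_ege1// lerDl ltW.
  have Bn : B <= (1 + w) ^+ n * a.
    by apply: (le_trans Ba); rewrite ler_peMl// ltW// (lt_le_trans B0).
  rewrite !exprS invfM -mulrA; apply: le_trans (half _ Bn).
  by rewrite mulrCA mulrC ler_pM2r ?invr_gt0.
(* By Bernoulli's inequality, any [n] above [u / w] will do. *)
have [n un] : exists n, u <= (1 + w) ^+ n.
  have bernoulli n : 1 + n%:R * w <= (1 + w) ^+ n.
    elim: n => [|n IH]; first by rewrite mul0r addr0 expr0.
    rewrite exprS; apply: (@le_trans _ _ ((1 + w) * (1 + n%:R * w))).
      have : 0 <= n%:R * w * w by rewrite !mulr_ge0// ltW.
      by rewrite -natr1; lra.
    by rewrite ler_pM2l// addr_gt0.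
  exists (Num.bound (u / w)); apply: le_trans (bernoulli _).
  have : u / w < (Num.bound (u / w))%:R.
    by apply: archi_boundP; rewrite divr_ge0 ?(ltW w0)//; lra.
  by rewrite ltr_pdivrMr//; lra.
apply/limf_einf_gt0P; exists (2 ^- n); first by rewrite invr_gt0 exprn_gt0.
apply/near_pinftyP; exists B => // x Bx.
rewrite ler_pdivlMr ?tail_gt0// mulrC; apply: le_trans (halfX n _ Bx) _.
by apply: tail_nonincreasing; rewrite ler_wpM2r// ltW// (lt_le_trans B0).
Qed.

Lemma hazard_bounded_long_tailed :
  (limf_esup (fun x : R => (x * hazard_rate F f x)%:E) +oo%R < +oo)%E ->
  long_tailed F.
Proof.
move=> /hazard_bounded_tail_sub[M M0 [B B0 TM]].
(* Right shifts come first: monotonicity bounds the ratio by 1, and the increment bound keeps it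
   above [1 - M z / x]. *)
have right z : 0 <= z -> tail F (x + z) / tail F x @[x --> +oo] --> (1 : R).
  move=> z0; apply: (@squeeze_cvgr _ _ _ _ (fun x => 1 - M * z / x) (fun=> 1)).
  - apply/near_pinftyP; exists B => // x Bx.
    have x0 : 0 < x by exact: lt_le_trans Bx.
    have xz : x <= x + z by rewrite lerDl.
    rewrite ler_pdivlMr ?ler_pdivrMr ?tail_gt0// mul1r tail_nonincreasing// andbT.
    have := TM _ _ Bx xz.
    have -> : M * tail F x / x * (x + z - x) = M * z / x * tail F x.
      by field; rewrite gt_eqF.
    lra.
  - rewrite -[X in _ --> X]subr0; apply: cvgB; first exact: cvg_cst.
    rewrite -[X in _ --> X](mulr0 (M * z)); apply: cvgM; first exact: cvg_cst.
    apply/cvgr0Pnorm_le => e e0; apply/near_pinftyP; exists e^-1.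
      by rewrite invr_gt0.
    move=> x ex; have x0 : 0 < x by apply: lt_le_trans ex; rewrite invr_gt0.
    by rewrite gtr0_norm ?invr_gt0// invf_ple.
  - exact: cvg_cst.
move=> y; have [y0|/ltW y0] := leP y 0; first by apply: right; rewrite oppr_ge0.
have shift : x - y @[x --> +oo] --> +oo.
  move=> P /near_pinftyP[D D0 DP]; apply/near_pinftyP; exists (D + y).
    by rewrite ltr_wpDr.
  by move=> x Dx; apply: DP; rewrite lerBrDr.
(* For [y > 0] the ratio is the inverse of a right-shift ratio taken at [x - y], which also tends to
   infinity. *)
have -> : (fun x => tail F (x - y) / tail F x) =
    (fun x => (tail F (x - y + y) / tail F (x - y))^-1).
  by apply/funext => x; rewrite subrK invf_div.
rewrite -[X in _ --> X]invr1; apply: cvgV; first exact: oner_neq0.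
exact: cvg_comp shift (right y y0).
Qed.

End tail_asymptotics.

End tail.

Theorem theorem3p2 (R : realType)
    (F : probability (measurableTypeR R) R) (f : R -> R)
    (F_supp : F `]0, +oo[%classic = 1%E)
    (f_meas : measurable_fun (`]0, +oo[%classic : set R) f)
    (f_pos : forall x : R, 0 < x -> 0 < f x)
    (f_density : forall A : set R, measurable A -> A `<=` `]0, +oo[%classic ->
       F A = (\int[lebesgue_measure]_(x in A) (f x)%:E)%E)
    (f_bi : bounded_increase f) :
  let M2 : \bar R :=
    limf_esup (fun x : R => (x * hazard_rate F f x)%:E) +oo%R in
  [<-> dominatedly_varying F;
       dominatedly_varying F /\ long_tailed F;
       (M2 < +oo)%E].
Proof.
have [K K0 [A A0 fK]] := bounded_increase_doubling _ _ f_pos f_bi.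
move=> M2; tfae.
(* The long tail is reached through the bound on [x * h x]. *)
- move=> DF; split=> //.
  apply: (hazard_bounded_long_tailed _ _ _ f_meas f_pos f_density _ _ K0 A0 fK).
  exact: (dominatedly_varying_hazard_bounded _ _ _ f_meas f_pos f_density _ _ K0 A0 fK).
- move=> [DF _].
  exact: (dominatedly_varying_hazard_bounded _ _ _ f_meas f_pos f_density _ _ K0 A0 fK).
- exact: (hazard_bounded_dominatedly_varying _ _ _ f_meas f_pos f_density _ _ K0 A0 fK).
Qed.
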